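(* The maximum reliable horizontal sensing radius of a UAV at altitude $H$ satisfies $$r_{\mathrm s}=\min\!\left(\sup\{r\ge 0: P_{\mathrm d}^{\mathrm{cond}}(r)\ge\delta\},\; r_{\mathrm L}\right)=\min\!\left(r_{\mathrm s}^{\mathrm{snr}},\,r_{\mathrm L}\right),$$ where $r_{\mathrm s}^{\mathrm{snr}}=\sqrt{d_{\mathrm s}^2-H^2}$ and $$d_{\mathrm s}=\frac{\alpha}{\kappa_f}\,W\!\left(\frac{\kappa_f}{\alpha}\left(\frac{-\ln(\delta)\,P_{\mathrm t}\,G_{\mathrm s}^2(\gamma)\,\lambda_c^2\,\bar\sigma}{\tau_{\mathrm s}(4\pi)^3N_0}\right)^{\frac{1}{2\alpha}}\right),$$ with $W$ the principal branch of the Lambert function.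
   Context: Constants: UAV altitude $H>0$, beamwidth $\gamma>0$, transmit power $P_{\mathrm t}>0$, carrier wavelength $\lambda_c>0$, noise power $N_0>0$, path-loss exponent $\alpha>0$, absorption coefficient $\kappa_f>0$, sensing threshold $\tau_{\mathrm s}>0$, mean radar cross section $\bar\sigma>0$, reliability threshold $\delta\in(0,1)$, main-lobe gain $G_{\mathrm s}(\gamma)=2\pi/(3\gamma)$, blockage parameter $a\in(0,90)$ (in degrees). The blockage-limited radius is $r_{\mathrm L}=H/\tan(\pi a/180)$. For the purpose of defining the sensing radius, the LoS probability is taken to be its step-function limit: $p_{\mathsf L}(r,H)=1$ for $0\le r<r_{\mathrm L}$ and $p_{\mathsf L}(r,H)=0$ for $r>r_{\mathrm L}$ (its value at $r=r_{\mathrm L}$ is any number in $[0,1]$). The conditional detection probability is $$P_{\mathrm d}^{\mathrm{cond}}(r)=p_{\mathsf L}(r,H)\exp\!\left(-\frac{\tau_{\mathrm s}(4\pi)^3d^{2\alpha}N_0e^{2\kappa_f d}}{P_{\mathrm t}G_{\mathrm s}^2(\gamma)\lambda_c^2\bar\sigma}\right),\qquad d=\sqrt{r^2+H^2}.$$ The maximum reliable sensing radius is $r_{\mathrm s}=\sup\{r\ge0:P_{\mathrm d}^{\mathrm{cond}}(r)\ge\delta\}$. It is assumed that $d_{\mathrm s}\ge H$, so that $r_{\mathrm s}^{\mathrm{snr}}$ is a real number. *)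

(* Defs.v *)
From HB Require Import structures.
From mathcomp Require Import all_boot all_order all_algebra.
From mathcomp Require Import all_classical all_reals all_analysis.

Set Implicit Arguments.
Unset Strict Implicit.
Unset Printing Implicit Defensive.

Import Order.TTheory GRing.Theory Num.Theory.
Import numFieldNormedType.Exports.

Local Open Scope classical_set_scope.
Local Open Scope ring_scope.

(* Principal branch of the Lambert function: for x >= - 1 / e, the unique
   w >= -1 such that w e^w = x.  For x < - 1 / e there is no such w and the
   value is 0 by convention. *)
Definition lambertW (R : realType) (x : R) : R :=
  xget 0 [set w : R | -1 <= w /\ w * expR w = x].

Definition mainlobe_gain (R : realType) (gamma : R) : R :=
  2 * pi / (3 * gamma).

(* The blockage parameter a is an angle in degrees. *)
Definition blockage_radius (R : realType) (H a : R) : R :=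
  H / tan (pi * a / 180).

(* Step-function limit of the line-of-sight probability; p is its (arbitrary)
   value at the jump. *)
Definition los_prob (R : realType) (H a p r : R) : R :=
  if r < blockage_radius H a then 1
  else if r == blockage_radius H a then p
  else 0.

Definition slant_distance (R : realType) (H r : R) : R :=
  Num.sqrt (r ^+ 2 + H ^+ 2).

Definition cond_detection_prob (R : realType)
    (H gamma Pt lambda_c N0 alpha kappa_f tau_s sigma_bar a p r : R) : R :=
  let d := slant_distance H r in
  los_prob H a p r *
  expR (- (tau_s * (4 * pi) ^+ 3 * d `^ (2 * alpha) * N0
             * expR (2 * kappa_f * d)
           / (Pt * mainlobe_gain gamma ^+ 2 * lambda_c ^+ 2 * sigma_bar))).

Definition reliable_radii (R : realType)
    (H gamma Pt lambda_c N0 alpha kappa_f tau_s sigma_bar delta a p : R) :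
    set R :=
  [set r | 0 <= r /\
     delta <= cond_detection_prob H gamma Pt lambda_c N0 alpha kappa_f tau_s
                sigma_bar a p r].

(* [sup] is 0 on a set that is empty or unbounded above. *)
Definition sensing_radius (R : realType)
    (H gamma Pt lambda_c N0 alpha kappa_f tau_s sigma_bar delta a p : R) : R :=
  sup (reliable_radii H gamma Pt lambda_c N0 alpha kappa_f tau_s sigma_bar
         delta a p).

Definition snr_distance (R : realType)
    (gamma Pt lambda_c N0 alpha kappa_f tau_s sigma_bar delta : R) : R :=
  alpha / kappa_f *
  lambertW (kappa_f / alpha *
    (- ln delta * Pt * mainlobe_gain gamma ^+ 2 * lambda_c ^+ 2 * sigma_bar
       / (tau_s * (4 * pi) ^+ 3 * N0)) `^ (1 / (2 * alpha))).

Definition snr_radius (R : realType)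
    (H gamma Pt lambda_c N0 alpha kappa_f tau_s sigma_bar delta : R) : R :=
  Num.sqrt (snr_distance gamma Pt lambda_c N0 alpha kappa_f tau_s sigma_bar
              delta ^+ 2 - H ^+ 2).

(* Main.v *)
(* With d = sqrt (r^2 + H^2), the condition P_d^cond(r) >= delta away from the
   blockage radius reads d^(2 alpha) e^(2 kappa d) <= B for a constant B.  Taking
   the power 1 / (2 alpha) turns it into u e^u <= x with u = kappa d / alpha, that
   is u <= W(x), i.e. d <= d_s.  Hence the reliable radii form the interval from 0
   to min(r_s^snr, r_L), whose right endpoint may be missing. *)

Require Import Defs.
From HB Require Import structures.
From mathcomp Require Import all_boot all_order all_algebra.
From mathcomp Require Import all_classical all_reals all_analysis.
From mathcomp Require Import ring.

Set Implicit Arguments.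
Unset Strict Implicit.
Unset Printing Implicit Defensive.

Import Order.TTheory GRing.Theory Num.Theory.
Import numFieldNormedType.Exports.

Local Open Scope classical_set_scope.
Local Open Scope ring_scope.

Lemma ltr_mul_expR (R : realType) :
  {in Num.nneg &, {homo (fun w : R => w * expR w) : x y / x < y}}.
Proof.
move=> x y; rewrite !nnegrE => x0 y0 xy.
by rewrite ltr_pM // ?expR_ge0 ?ltr_expR.
Qed.

Lemma ler_mul_expR (R : realType) :
  {in Num.nneg &, {mono (fun w : R => w * expR w) : x y / x <= y}}.
Proof. exact/le_mono_in/ltr_mul_expR. Qed.

(** A solution exists by the intermediate value theorem on [[0, x]], since [0 <= x <= x * expR x].
    It is the only one at or above [-1]: as [expR w > 0], every solution is nonnegative, and
    [w * expR w] is injective there. So [xget] picks from a singleton. *)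
Lemma lambertW_spec (R : realType) (x : R) : 0 <= x ->
  0 <= lambertW x /\ lambertW x * expR (lambertW x) = x.
Proof.
move=> x0.
have [w w_in wx] : exists2 w, w \in `[0, x] & w * expR w = x.
  apply: IVT => //.
    apply: continuous_subspaceT => t.
    by apply: cvgM; [exact: cvg_id | exact: continuous_expR].
  have x_le : x <= x * expR x by rewrite ler_peMr // -expR0 ler_expR.
  by rewrite mul0r ge_min le_max x0 x_le orbT.
have w0 : 0 <= w by move: w_in; rewrite in_itv /= => /andP[].
have nonneg v : v * expR v = x -> 0 <= v.
  by move=> vx; rewrite -(pmulr_lge0 _ (expR_gt0 v)) vx.
suff -> : lambertW x = w by [].
apply: xget_subset1; first by split=> //; exact: le_trans (lerN10 R) w0.
move=> u v [_ ux] [_ vx].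
by apply: (inc_inj_in (@ler_mul_expR R)); rewrite ?nnegrE ?nonneg ?ux.
Qed.

Lemma le_lambertW (R : realType) (u x : R) : 0 <= u -> 0 <= x ->
  (u <= lambertW x) = (u * expR u <= x).
Proof.
move=> u0 /lambertW_spec[W0 {2}<-].
by rewrite (ler_mul_expR (R := R)) ?nnegrE.
Qed.

Lemma ler_powR_root (R : realType) (x y r : R) : 0 < r -> 0 <= x -> 0 <= y ->
  (x `^ r <= y) = (x <= y `^ (1 / r)).
Proof.
move=> r0 x0 y0.
have mono := le_mono_in (gt0_ltr_powR r0).
rewrite -[in RHS]mono ?nnegrE ?powR_ge0 // -powRrM div1r mulVf ?gt_eqF //.
by rewrite powRr1.
Qed.

Lemma powR_mul_expR_le (R : realType) (alpha kappa d B : R) :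
    0 < alpha -> 0 < kappa -> 0 <= d -> 0 <= B ->
  (d `^ (2 * alpha) * expR (2 * kappa * d) <= B) =
  (d <= alpha / kappa * lambertW (kappa / alpha * B `^ (1 / (2 * alpha)))).
Proof.
move=> alpha0 kappa0 d0 B0.
have c0 : 0 < kappa / alpha by rewrite divr_gt0.
have -> : 2 * kappa * d = kappa / alpha * d * (2 * alpha).
  by field; rewrite gt_eqF.
rewrite expRM -powRM ?expR_ge0 // ler_powR_root ?mulr_gt0 ?mulr_ge0 ?expR_ge0 //.
rewrite -[alpha / kappa]invf_div ler_pdivlMl //.
rewrite le_lambertW ?(pmulr_rge0 _ c0) ?powR_ge0 //.
by rewrite -(mulrA _ d) ler_pM2l.
Qed.

Lemma mainlobe_gain_gt0 (R : realType) (gamma : R) :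
  0 < gamma -> 0 < mainlobe_gain gamma.
Proof. by move=> ?; rewrite divr_gt0 ?mulr_gt0 ?pi_gt0. Qed.

Lemma blockage_radius_gt0 (R : realType) (H a : R) :
  0 < H -> 0 < a -> a < 90 -> 0 < blockage_radius H a.
Proof.
move=> H0 a0 a90.
have t0 : 0 < pi * a / 180 :> R by rewrite divr_gt0 ?mulr_gt0 ?pi_gt0.
have t2 : pi * a / 180 < pi / 2 :> R.
  rewrite -mulrA ltr_pM2l ?pi_gt0 // ltr_pdivrMr //.
  by have -> : 2^-1 * 180 = 90 :> R by field.
rewrite divr_gt0 // divr_gt0 ?sin_gt0_pihalf ?cos_gt0_pihalf ?t0 ?t2 //.
by rewrite andbT (lt_trans _ t0) // oppr_lt0 divr_gt0 ?pi_gt0.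
Qed.

(** Both sides square to [r ^+ 2 + H ^+ 2 <= d ^+ 2]. The bound [H <= d] excludes a negative
    radicand, whose root is 0 by convention and would wrongly admit [r = 0]. *)
Lemma slant_distance_le (R : realType) (H r d : R) :
  0 <= r -> 0 <= H -> H <= d ->
  (slant_distance H r <= d) = (r <= Num.sqrt (d ^+ 2 - H ^+ 2)).
Proof.
move=> r0 H0 Hd; have d0 : 0 <= d := le_trans H0 Hd.
have dH : 0 <= d ^+ 2 - H ^+ 2 by rewrite subr_ge0 ler_sqr ?nnegrE.
rewrite -{1}(ger0_norm d0) -sqrtr_sqr ler_sqrt ?sqr_ge0 // -lerBrDr.
by rewrite -{2}(ger0_norm r0) -sqrtr_sqr ler_sqrt.
Qed.

Lemma snr_condition (R : realType)
    (H gamma Pt lambda_c N0 alpha kappa_f tau_s sigma_bar delta r : R) :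
    0 < H -> 0 < gamma -> 0 < Pt -> 0 < lambda_c -> 0 < N0 -> 0 < alpha ->
    0 < kappa_f -> 0 < tau_s -> 0 < sigma_bar -> 0 < delta -> delta < 1 ->
    H <= snr_distance gamma Pt lambda_c N0 alpha kappa_f tau_s sigma_bar
           delta ->
    0 <= r ->
  (delta <= expR (- (tau_s * (4 * pi) ^+ 3 * slant_distance H r `^ (2 * alpha)
                       * N0 * expR (2 * kappa_f * slant_distance H r)
             / (Pt * mainlobe_gain gamma ^+ 2 * lambda_c ^+ 2 * sigma_bar)))) =
  (r <= snr_radius H gamma Pt lambda_c N0 alpha kappa_f tau_s sigma_bar delta).
Proof.
move=> H0 gamma0 Pt0 lambda0 N00 alpha0 kappa0 tau0 sigma0 delta0 delta1 Hds r0.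
rewrite -slant_distance_le ?(ltW H0) // /snr_distance.
move: (mainlobe_gain gamma) (mainlobe_gain_gt0 gamma0) => g g0.
set d := slant_distance H r.
have d0 : 0 <= d := sqrtr_ge0 _.
have G0 : 0 < Pt * g ^+ 2 * lambda_c ^+ 2 * sigma_bar.
  by rewrite !mulr_gt0.
have K0 : 0 < tau_s * (4 * pi) ^+ 3 * N0.
  by rewrite !mulr_gt0 ?pi_gt0.
(* Since [delta < 1], the base of the power inside [lambertW] is positive, so the Lambert inversion
   applies. *)
have ln0 : 0 < - ln delta by rewrite oppr_gt0 ln_lt0 // delta0.
rewrite -powR_mul_expR_le //; last first.
  by rewrite ltW // divr_gt0 // !mulr_gt0.
rewrite -[X in X <= _](@lnK R delta) ?posrE // ler_expR lerNr.
rewrite ler_pdivrMr // ler_pdivlMr //.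
by congr (_ <= _); ring.
Qed.

(** If [sup A < m], the midpoint of the two would be a member of [A] above its supremum. Membership
    of [m] is left open because the value at the jump can decide it; [A 0] also covers [m = 0]. *)
Lemma sup_initial_segment (R : realType) (A : set R) (m : R) : A 0 ->
    (forall r, A r -> r <= m) -> (forall r, 0 <= r -> r < m -> A r) ->
  has_sup A /\ sup A = m.
Proof.
move=> A0 Am mA.
have hA : has_sup A by split; [exists 0 | exists m].
split=> //; apply/le_anti/andP; split; first by apply: ge_sup => //; exists 0.
rewrite leNgt; apply/negP => lt_sup_m.
have sup0 : 0 <= sup A by apply: ub_le_sup => //; case: hA.
have [lt_mid mid_lt] := midf_lt lt_sup_m.
have /(ub_le_sup hA.2) : A ((sup A + m) / 2).
  by apply: mA => //; exact: le_trans sup0 (ltW _).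
by rewrite leNgt lt_mid.
Qed.

Theorem theorem2 (R : realType)
    (H gamma Pt lambda_c N0 alpha kappa_f tau_s sigma_bar delta a p : R)
    (H_gt0 : 0 < H) (gamma_gt0 : 0 < gamma) (Pt_gt0 : 0 < Pt)
    (lambda_c_gt0 : 0 < lambda_c) (N0_gt0 : 0 < N0) (alpha_gt0 : 0 < alpha)
    (kappa_f_gt0 : 0 < kappa_f) (tau_s_gt0 : 0 < tau_s)
    (sigma_bar_gt0 : 0 < sigma_bar)
    (delta_gt0 : 0 < delta) (delta_lt1 : delta < 1)
    (a_gt0 : 0 < a) (a_lt90 : a < 90)
    (p_ge0 : 0 <= p) (p_le1 : p <= 1)
    (H_le_ds : H <= snr_distance gamma Pt lambda_c N0 alpha kappa_f tau_s
                      sigma_bar delta) :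
  [/\ has_sup (reliable_radii H gamma Pt lambda_c N0 alpha kappa_f tau_s
                 sigma_bar delta a p),
      sensing_radius H gamma Pt lambda_c N0 alpha kappa_f tau_s sigma_bar
          delta a p =
        Num.min
          (sup [set r : R | 0 <= r /\
             delta <= cond_detection_prob H gamma Pt lambda_c N0 alpha kappa_f
                        tau_s sigma_bar a p r])
          (blockage_radius H a)
    & sensing_radius H gamma Pt lambda_c N0 alpha kappa_f tau_s sigma_bar
          delta a p =
        Num.min
          (snr_radius H gamma Pt lambda_c N0 alpha kappa_f tau_s sigma_bar
             delta)
          (blockage_radius H a)].
Proof.
set S := reliable_radii _ _ _ _ _ _ _ _ _ _ _ _.
set m := Num.min (snr_radius _ _ _ _ _ _ _ _ _ _) _.
have rL0 := blockage_radius_gt0 H_gt0 a_gt0 a_lt90.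
have snrP r : 0 <= r -> _ := snr_condition H_gt0 gamma_gt0 Pt_gt0 lambda_c_gt0
  N0_gt0 alpha_gt0 kappa_f_gt0 tau_s_gt0 sigma_bar_gt0 delta_gt0 delta_lt1
  H_le_ds (r := r).
(* The bound by [snr_radius] is not strict, so that [r = 0] qualifies even when the SNR radius
   vanishes. *)
have mem_S r : 0 <= r -> r < blockage_radius H a ->
    r <= snr_radius H gamma Pt lambda_c N0 alpha kappa_f tau_s sigma_bar delta ->
    S r.
  move=> r0 r_rL r_snr; split=> //.
  by rewrite /cond_detection_prob /los_prob r_rL mul1r snrP.
have [hS supS] : has_sup S /\ sup S = m.
  apply: sup_initial_segment => [|r [r0]|r r0].
  - by apply: mem_S; rewrite ?sqrtr_ge0.
  - rewrite /cond_detection_prob /los_prob le_min -snrP //.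
    (* Beyond the blockage radius the probability is [0 < delta]; at the jump, [p <= 1] can only
       lower it, so the SNR bound still follows. *)
    case: ltgtP => _; rewrite ?mul1r ?andbT //.
    + by rewrite mul0r leNgt delta_gt0.
    + by move=> /le_trans; apply; rewrite ler_piMl ?expR_ge0.
  - by rewrite lt_min => /andP[r_snr r_rL]; apply: mem_S => //; exact: ltW.
split=> //; rewrite /sensing_radius -/S.
(* The inner supremum is over the same set [S], so the identity amounts to
   [sup S <= blockage_radius H a], which [supS] gives. *)
rewrite -[X in Num.min (sup X) _]/S.
by apply/esym/min_idPl; rewrite supS ge_min lexx orbT.
Qed.
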